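(* Let $0<p<1/2$ and let $\varphi:\mathbf{P}_+\to[1,\infty)$ be a nondecreasing function satisfying $$\limsup_{n\to\infty}\frac{n^{1/p-2}}{\varphi(n)}=+\infty.$$ Then there exists a martingale $f\in H_p(G)$ such that $$\sup_{n\geq 1}\left\|\frac{\sigma_n^{\kappa}f}{\varphi(n)}\right\|_{L_{p,\infty}(G)}=\infty.$$
   Context: Let $\mathbf{P}_+$ be the set of positive integers and $\mathbf{P}=\mathbf{P}_+\cup\{0\}$. Let $\mathbb{Z}_2=\{0,1\}$ be the discrete cyclic group of order 2 with the measure giving each singleton mass $1/2$. The Walsh group $G$ is the complete direct product of countably many copies of $\mathbb{Z}_2$, with elements $x=(x_0,x_1,\dots)$, $x_k\in\{0,1\}$, with coordinatewise addition modulo 2, product topology and product (Haar probability) measure $\mu$. For $x\in G$, $n\in\mathbf{P}$, the dyadic intervals are $I_0(x):=G$ and $I_n(x):=\{y\in G: y_i=x_i \text{ for } 0\le i<n\}$. Walsh-Kaczmarz system: $r_k(x):=(-1)^{x_k}$ is the $k$-th Rademacher function. For $n\in\mathbf{P}_+$ with binary expansion $n=\sum_{i\ge 0}n_i2^i$, $n_i\in\{0,1\}$, put $|n|:=\max\{j\in\mathbf{P}: n_j\neq 0\}$. Then $\kappa_0:=1$ and for $n\geq 1$ $$\kappa_n(x):=r_{|n|}(x)\prod_{k=0}^{|n|-1}\left(r_{|n|-1-k}(x)\right)^{n_k}.$$ Martingales and function spaces: $F_k$ is the $\sigma$-algebra generated by the dyadic intervals of measure $2^{-k}$. A martingale $f=(f^{(n)}:n\in\mathbf{P})$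 is a martingale with respect to $(F_n:n\in\mathbf{P})$ on $(G,\mu)$. Its maximal function is $f^*:=\sup_{n\in\mathbf{P}}|f^{(n)}|$. For $0<p<\infty$, $\|g\|_p:=\left(\int_G|g|^p\,d\mu\right)^{1/p}$, and $H_p(G)$ consists of all martingales $f$ with $\|f\|_{H_p}:=\|f^*\|_p<\infty$. The weak space $L_{p,\infty}(G)$ has quasinorm $\|g\|_{L_{p,\infty}}:=\sup_{\lambda>0}\lambda\,\mu\{|g|>\lambda\}^{1/p}$. Fourier coefficients and Fejér means: for a martingale $f$, the Walsh-Kaczmarz-Fourier coefficients are $\widehat{f}(i):=\lim_{k\to\infty}\int_G f^{(k)}\kappa_i\,d\mu$ for $i\in\mathbf{P}$, the partial sums are $S_M^{\kappa}f:=\sum_{i=0}^{M-1}\widehat{f}(i)\kappa_i$ (with $S_0^{\kappa}f:=0$), and for $n\ge 1$ the Walsh-Kaczmarz-Fejér means are $\sigma_n^{\kappa}f:=\frac1n\sum_{j=0}^{n-1}S_j^{\kappa}f$. *)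

(* Defs.v *)
From HB Require Import structures.
From mathcomp Require Import all_boot all_order all_algebra.
From mathcomp Require Import zify lra.
From mathcomp Require Import all_classical all_reals all_analysis.

Set Implicit Arguments.
Unset Strict Implicit.
Unset Printing Implicit Defensive.

Import Order.TTheory GRing.Theory Num.Theory.
Import numFieldNormedType.Exports.

Local Open Scope classical_set_scope.
Local Open Scope ring_scope.

(* The carrier is the product space [nat -> bool], with [true] for 1, and the
   sigma-algebra is the product of the discrete ones: it is generated by the
   coordinate projections. *)
Definition coordinate_sets : set (set cantor_space) :=
  \bigcup_k preimage_set_system setT (fun x : cantor_space => x k) setT.

Definition walsh_group : Type := g_sigma_algebraType coordinate_sets.
HB.instance Definition _ := Measurable.on walsh_group.

Definition fair_coin (R : realType) : probability bool R :=
  bernoulli_prob (2^-1 : R).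

Definition is_product_measure (R : realType)
    (P : probability walsh_group R) : Prop :=
  forall (n : nat) (A : nat -> set bool),
    P [set x | forall i, (i < n)%N -> A i (x i)]
    = (\prod_(i < n) fair_coin R (A i))%E.

Section product_measure_exists.
Context {R : realType}.
Local Notation G := walsh_group.

Let bdigit (k : nat) (x : R) : bool := odd (Num.truncn (x * 2 ^+ k.+1)).
Let digits (x : R) : G := fun k => bdigit k x.

Lemma measurable_coordinate (k : nat) (B : set bool) :
  measurable [set x : G | B (x k)].
Proof.
apply: sub_sigma_algebra; exists k => //; exists B => //.
by rewrite setTI.
Qed.

Lemma measurable_rectangle (n : nat) (A : nat -> set bool) :
  measurable [set x : G | forall i, (i < n)%N -> A i (x i)].
Proof.
rewrite (_ : [set _ | _] = \bigcap_(i in `I_n) [set x : G | A i (x i)]).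
  by apply: bigcap_measurableType => k _; exact: measurable_coordinate.
by apply/seteqP; split=> x /= h i; exact: h.
Qed.

Let measurable_trunc_eq (c : R) (j : nat) : 0 < c ->
  measurable [set x : R | Num.truncn (x * c) = j].
Proof.
move=> c0.
have mle (i : nat) : measurable [set x : R | (i < Num.truncn (x * c))%N].
  rewrite (_ : [set _ | _] = `[i.+1%:R / c, +oo[%classic) //.
  apply/seteqP; split=> x /=; rewrite in_itv/= andbT truncn_gt_nat.
    by rewrite ler_pdivrMr.
  by rewrite ler_pdivrMr.
case: j => [|j].
  rewrite (_ : [set _ | _] = ~` [set x : R | (0 < Num.truncn (x * c))%N]).
    exact: measurableC.
  by apply/seteqP; split=> x /=; [move=> ->|move=> /negP; rewrite lt0n negbK => /eqP].
rewrite (_ : [set _ | _] = [set x : R | (j < Num.truncn (x * c))%N] `\`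
   [set x : R | (j.+1 < Num.truncn (x * c))%N]).
  exact: measurableD.
apply/seteqP; split=> x /=; first by move=> ->; rewrite ltnSn ltnn.
by move=> [h1 /negP]; rewrite -leqNgt => h2; apply/eqP; rewrite eqn_leq h1 h2.
Qed.

Let measurable_bdigit k (B : set bool) : measurable (bdigit k @^-1` B).
Proof.
rewrite (_ : _ @^-1` _ = \bigcup_(j in [set j | B (odd j)])
    [set x : R | Num.truncn (x * 2 ^+ k.+1) = j]).
  by apply: bigcup_measurable => j _; apply: measurable_trunc_eq; rewrite exprn_gt0.
apply/seteqP; split=> x /=; first by move=> h; exists (Num.truncn (x * 2 ^+ k.+1)).
by move=> [j /= Bj jE]; rewrite /bdigit jE.
Qed.

Let measurable_digits : measurable_fun setT digits.
Proof.
apply: (@measurability _ _ (measurableTypeR R) walsh_group setT digits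
  coordinate_sets erefl).
move=> _ [_ [k _ [B _ <-]] <-].
by rewrite !setTI; exact: measurable_bdigit.
Qed.


Let mI : measurable (`[0, 1[%classic : set R).
Proof. by []. Qed.

(* The image of Lebesgue measure on [0, 1[ under binary expansion. *)
Definition digit_measure : set G -> \bar R :=
  pushforward (mrestr (@lebesgue_measure R) mI) digits.

Let digit_measure0 : digit_measure set0 = 0%E.
Proof. by rewrite /digit_measure /pushforward preimage_set0 measure0. Qed.

Let digit_measure_ge0 A : (0 <= digit_measure A)%E.
Proof. exact: measure_ge0. Qed.

Let digit_measure_sigma_additive : semi_sigma_additive digit_measure.
Proof.
exact: (@measure_semi_sigma_additive _ _ _
  (pushforward (mrestr (@lebesgue_measure R) mI) digits
    : {measure set _ -> \bar _})).
Qed.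

HB.instance Definition _ := isMeasure.Build _ _ _ digit_measure
  digit_measure0 digit_measure_ge0 digit_measure_sigma_additive.

Let digit_measure_setT : digit_measure setT = 1%E.
Proof.
rewrite /digit_measure /pushforward preimage_setT /mrestr setTI.
by rewrite lebesgue_measure_itv/= lte_fin ltr01 sube0.
Qed.

HB.instance Definition _ :=
  Measure_isProbability.Build _ _ _ digit_measure digit_measure_setT.

Let prefix (w : nat -> bool) :=
  fix F n := if n is m.+1 then ((F m).*2 + w m)%N else 0%N.

Let prefix_lt w n : (prefix w n < 2 ^ n)%N.
Proof.
elim: n => //= n ih; rewrite expnS mul2n -!addnn.
case: (w n); lia.
Qed.

Let trunc_half (y : R) : 0 <= y -> (Num.truncn (2 * y))./2 = Num.truncn y.
Proof.
move=> y0; apply/esym/truncn_def.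
have /andP[] : (Num.truncn (2 * y))%:R <= 2 * y < (Num.truncn (2 * y)).+1%:R.
  by apply: truncn_itv; rewrite mulr_ge0.
set t := Num.truncn _; set h := t./2.
have tE : t%:R = (odd t)%:R + (h%:R + h%:R) :> R.
  by rewrite -!natrD addnn odd_double_half.
rewrite -!natr1 tE => h1 h2.
have b0 : 0 <= (odd t)%:R :> R by rewrite ler0n.
have b1 : (odd t)%:R <= 1 :> R by case: (odd t).
by apply/andP; split; lra.
Qed.

Let digits_prefix (w : nat -> bool) n (x : R) : 0 <= x < 1 ->
  (forall i, (i < n)%N -> digits x i = w i) <->
  Num.truncn (x * 2 ^+ n) = prefix w n.
Proof.
move=> /andP[x0 x1]; elim: n => [|n ih] /=.
  split=> // _; rewrite expr0 mulr1; apply: truncn_def.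
  by rewrite x0 x1.
have E : Num.truncn (x * 2 ^+ n.+1)
    = ((Num.truncn (x * 2 ^+ n)).*2 + digits x n)%N.
  rewrite -(trunc_half (y := x * 2 ^+ n)) ?mulr_ge0 ?exprn_ge0//.
  by rewrite [2 * _]mulrCA -exprS addnC -[LHS]odd_double_half.
rewrite E; split=> [h|h].
  by rewrite (h n)// ih.1// => i ni; apply: h; rewrite ltnS ltnW.
have dn : digits x n = w n.
  move: (congr1 odd h); rewrite !oddD !odd_double /=.
  by case: (digits x n) (w n) => -[].
move=> i; rewrite ltnS leq_eqVlt => /orP[/eqP -> //|]; apply: ih.2.
by move: h; rewrite dn => /addIn/double_inj.
Qed.

Let cyl (n : nat) (x : G) : set G :=
  [set y | forall i, (i < n)%N -> y i = x i].

Let digit_measure_cyl n w :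
  digit_measure (cyl n w) = (2 ^- n)%:E.
Proof.
have p0 : 0 < 2 ^+ n :> R by rewrite exprn_gt0.
rewrite /digit_measure /pushforward /mrestr.
rewrite (_ : _ `&` _ = `[(prefix w n)%:R / 2 ^+ n,
    (prefix w n).+1%:R / 2 ^+ n[%classic).
  rewrite lebesgue_measure_itv/= lte_fin ltr_pM2r ?invr_gt0// ltr_nat ltnSn.
  by rewrite -EFinD -mulrBl -natrB// subSnn mul1r.
apply/seteqP; split=> x /=; rewrite !in_itv/= ler_pdivrMr// ltr_pdivlMr//.
  move=> [h x01]; have /andP[x0 _] := x01.
  have /digits_prefix -/(_ x01) <- := h.
  by apply: truncn_itv; rewrite mulr_ge0// ltW.
move=> /andP[h1 h2].
have x0 : 0 <= x by rewrite -(pmulr_lge0 _ p0) (le_trans _ h1).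
have x1 : x < 1.
  rewrite -(ltr_pM2r p0) mul1r (lt_le_trans h2)// -natrX ler_nat.
  exact: prefix_lt.
split; last by rewrite x0 x1.
by apply/digits_prefix; rewrite ?x0 ?x1//; apply: truncn_def; rewrite h1 h2.
Qed.

Lemma fair_coin1 (b : bool) : fair_coin R [set b] = (2^-1)%:E.
Proof.
rewrite -[LHS]/(bernoulli_prob (2^-1 : R) [set b]).
rewrite bernoulli_probE ?invr_ge0 ?invf_le1//=; last first.
  by rewrite ler0n ler1n.
have bE c : (c \in [set b]) = (c == b) by apply/idP/eqP; rewrite in_setE.
by case: b bE => bE; rewrite /= !diracE !bE/= ?mule1 ?mule0 ?adde0 ?add0e//;
  congr (_%:E); rewrite /unstable.onem; lra.
Qed.

Lemma exists_product_measure :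
  exists P : probability G R, is_product_measure P.
Proof.
exists digit_measure; move=> n A /=.
pose rect B : set G := [set x | forall i, (i < n)%N -> B i (x i)].
suff H k (B : nat -> set bool) :
    (forall i, (k <= i < n)%N -> exists b, B i = [set b]) ->
    digit_measure (rect B) = (\prod_(i < n) fair_coin R (B i))%E.
  by apply: (H n) => i /andP[/leq_ltn_trans h /h]; rewrite ltnn.
elim: k B => [|k ih] B hB.
  have {}/choice[w hw] : forall i, exists b, (i < n)%N -> B i = [set b].
    move=> i; case: (ltnP i n) => [ni|_]; last by exists true.
    by have [b hb] := hB i ni; exists b.
  rewrite (_ : rect B = cyl n w); last first.
    by apply/seteqP; split=> x h i ni; move: (h i ni); rewrite hw.
  rewrite digit_measure_cyl (eq_bigr (fun=> (2^-1)%:E)); last first.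
    by move=> i _; rewrite hw// fair_coin1.
  by rewrite prodEFin prodr_const card_ord exprVn.
case: (ltnP k n) => [kn|nk]; last first.
  by apply: ih => i /andP[ki /(leq_ltn_trans ki)]; rewrite ltnNge nk.
pose C b i := if i == k then B i `&` [set b] else B i.
have E b : digit_measure (rect (C b)) = (\prod_(i < n) fair_coin R (C b i))%E.
  have [Bkb|Bkb] := pselect (B k b).
    apply: ih => i; rewrite leq_eqVlt /C eq_sym.
    case: eqP => [-> _|_ /= /hB//].
    by exists b; apply/seteqP; split=> [c []//|c /= ->].
  have C0 : C b k = set0.
    by rewrite /C eqxx; apply/seteqP; split=> // c [/[swap] /= ->].
  rewrite (bigD1 (Ordinal kn))//= C0 measure0 mul0e.
  rewrite (_ : rect _ = set0) ?measure0//.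
  by apply/seteqP; split=> // x /(_ k kn); rewrite C0.
rewrite (_ : rect B = rect (C true) `|` rect (C false)); last first.
  apply/seteqP; split=> x /=.
    move=> h; case xk : (x k); [left|right] => i ni; rewrite /C;
      by case: eqP => [ik|_]; [split; [exact: h|rewrite /= ik]|exact: h].
  by move=> [] h i ni; move: (h i ni); rewrite /C; case: eqP => // _ [].
have -> : digit_measure (rect (C true) `|` rect (C false))
    = (digit_measure (rect (C true)) + digit_measure (rect (C false)))%E.
  apply: measureU; [exact: measurable_rectangle|exact: measurable_rectangle|].
  apply/seteqP; split=> // x [/(_ k kn) + /(_ k kn)].
  by rewrite /C eqxx => -[_ /= ->] [_].
have rest b : (\prod_(i < n | i != Ordinal kn) fair_coin R (C b i)
    = \prod_(i < n | i != Ordinal kn) fair_coin R (B i))%E.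
  by apply: eq_bigr => i; rewrite /C -val_eqE /= => /negbTE ->.
rewrite !E.
rewrite [X in (X + _)%E](bigD1 (Ordinal kn))//.
rewrite [X in (_ + X)%E](bigD1 (Ordinal kn))//.
rewrite [RHS](bigD1 (Ordinal kn))// 2!rest.
have Ck b : C b (Ordinal kn) = B k `&` [set b] by rewrite /C/= eqxx.
rewrite (Ck true) (Ck false).
rewrite -ge0_muleDl; [|exact: measure_ge0|exact: measure_ge0].
congr (_ * _)%E; apply/esym.
have Bk : B k = (B k `&` [set true]) `|` (B k `&` [set false]).
  by rewrite -setIUr -setT_bool setIT.
rewrite {1}Bk; apply: measureU; [by []|by []|].
by apply/seteqP; split=> // c [[_ /= ->] [_]].
Qed.

Lemma product_measure_unique (P Q : probability G R) :
  is_product_measure P -> is_product_measure Q ->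
  forall A, measurable A -> P A = Q A.
Proof.
move=> hP hQ.
pose S : set (set G) := [set rect | exists n (A : nat -> set bool),
  rect = [set x | forall i, (i < n)%N -> A i (x i)]].
have ST : S setT by exists 0%N, (fun=> setT); apply/seteqP; split.
suff H : coordinate_sets `<=` S.
  move=> A mA.
  apply: (@g_sigma_algebra_measure_unique _ _ _ S _ (fun=> setT)) => //.
  - by move=> _ [n [B ->]]; exact: measurable_rectangle.
  - by rewrite bigcup_const//; exists 0%N.
  - move=> _ _ [n [B ->]] [m [C ->]].
    exists (maxn n m), (fun i => [set b | ((i < n)%N -> B i b) /\
      ((i < m)%N -> C i b)]).
    apply/seteqP; split=> x /=.
      by move=> [h1 h2] i _; split=> ?; [exact: h1|exact: h2].
    move=> h; split=> i im.
      by apply: (h i _).1 => //; rewrite leq_max im.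
    by apply: (h i _).2 => //; rewrite leq_max im orbT.
  - by move=> _ [n [B ->]]; exact: etrans (hP n B) (esym (hQ n B)).
  - by move=> _; exact: (le_lt_trans (probability_le1 P measurableT) (ltry 1)).
  - exact: sub_sigma_algebra2 mA.
move=> _ [k _ [B _ <-]].
exists k.+1, (fun i => [set b | i = k -> B b]).
apply/seteqP; split=> x /=; first by move=> [_ Bx] i _ ->.
by move=> h; split=> //; exact: (h k).
Qed.

End product_measure_exists.

Definition walsh_measure (R : realType) : probability walsh_group R :=
  sval (cid (@exists_product_measure R)).

Lemma walsh_measureP (R : realType) : is_product_measure (walsh_measure R).
Proof. by rewrite /walsh_measure; case: cid. Qed.

Definition dyadic_interval (n : nat) (x : walsh_group) : set walsh_group :=
  [set y | forall i, (i < n)%N -> y i = x i].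

Lemma measurable_dyadic_interval n x : measurable (dyadic_interval n x).
Proof. exact: (measurable_rectangle n (fun i => [set x i])). Qed.

Lemma walsh_measure_dyadic_interval (R : realType) n x :
  walsh_measure R (dyadic_interval n x) = (2 ^- n)%:E.
Proof.
transitivity (\prod_(i < n) fair_coin R [set x i])%E.
  exact: (walsh_measureP R n (fun i => [set x i])).
rewrite (eq_bigr (fun=> (2^-1)%:E)); last by move=> i _; exact: fair_coin1.
by rewrite prodEFin prodr_const card_ord exprVn.
Qed.

Definition dyadic_filtration (n : nat) : set_system walsh_group :=
  <<s range (dyadic_interval n) >>.

(* Adaptedness, integrability, and E[f_n | F_m] = f_m for m <= n, the latter
   through the defining property of conditional expectation. *)
Definition is_martingale d (T : measurableType d) (R : realType)
    (mu : {measure set T -> \bar R}) (F : nat -> set_system T)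
    (f : nat -> T -> R) : Prop :=
  [/\ forall n, g_sigma_algebra_preimage (f n) `<=` F n,
      forall n, mu.-integrable setT (EFin \o f n) &
      forall m n, (m <= n)%N -> forall A, F m A ->
        (\int[mu]_(x in A) (f n x)%:E = \int[mu]_(x in A) (f m x)%:E)%E].

Definition maximal_function (R : realType) (T : Type) (f : nat -> T -> R)
    (x : T) : \bar R :=
  ereal_sup (range (fun n => `|f n x|%:E)).

Definition weak_Lnorm d (T : measurableType d) (R : realType)
    (mu : {measure set T -> \bar R}) (p : R) (g : T -> R) : \bar R :=
  ereal_sup [set (l%:E * mu [set x | (l < `|g x|)%R] `^ p^-1)%E
            | l in [set l : R | 0 < l]].

Section walsh_kaczmarz.
Context {R : realType}.
Local Notation G := walsh_group.
Local Notation mu := (walsh_measure R).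

Definition dyadic_martingale (f : nat -> G -> R) : Prop :=
  is_martingale mu dyadic_filtration f.

Definition Hp_norm (p : R) (f : nat -> G -> R) : \bar R :=
  ('N[mu]_(p%:E)[maximal_function f])%E.

Definition in_Hp (p : R) (f : nat -> G -> R) : Prop :=
  dyadic_martingale f /\ (Hp_norm p f < +oo)%E.

Definition rademacher (k : nat) (x : G) : R := (-1) ^+ x k.

Definition binary_digit (n i : nat) : bool := odd (n %/ 2 ^ i).

(* |n|, the index of the leading binary digit of [n > 0]; digits of index at
   least [n] vanish. *)
Definition binary_order (n : nat) : nat :=
  \max_(j < n | binary_digit n j) j.

Definition kaczmarz (n : nat) (x : G) : R :=
  if n == 0%N then 1 else
  rademacher (binary_order n) x *
  \prod_(k < binary_order n)
    rademacher (binary_order n - 1 - k) x ^+ binary_digit n k.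

(* For a martingale the sequence of integrals is eventually constant. *)
Definition kaczmarz_coef (f : nat -> G -> R) (i : nat) : R :=
  limn (fun k => \int[mu]_x (f k x * kaczmarz i x)).

Definition kaczmarz_sum (f : nat -> G -> R) (m : nat) (x : G) : R :=
  \sum_(i < m) kaczmarz_coef f i * kaczmarz i x.

Definition kaczmarz_fejer (f : nat -> G -> R) (n : nat) (x : G) : R :=
  n%:R^-1 * \sum_(j < n) kaczmarz_sum f j x.

End walsh_kaczmarz.

(* Main.v *)
Require Import Defs.
From mathcomp Require Import all_boot all_order all_algebra.
From mathcomp Require Import all_classical all_reals all_analysis.
From mathcomp Require Import ring lra measurable_realfun.
Import Order.TTheory GRing.Theory Num.Theory.
Import numFieldNormedType.Exports.
Local Open Scope classical_set_scope.
Local Open Scope ring_scope.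

(** The counterexample is a lacunary sum of atoms. Let
    $h_A = r_A 2^A 1_{I_A(0)}$, which is the sum of all $\kappa_i$ with
    $2^A \leq i < 2^{A+1}$, and let $f^{(n)} = \sum_{A < n} d_A h_A$ with
    $d_A \geq 0$. The increments are odd in the last coordinate on which they
    depend, so this is a martingale ([haar_martingaleP]), and its
    Walsh-Kaczmarz coefficient of index $i > 0$ is $d_{|i|}$
    ([kaczmarz_coef_haar]).

    Upper bound. Since $p < 1$, the $p$-th power of the maximal function is at
    most $\sum_A (d_A 2^A)^p 1_{I_A(0)}$, and $I_A(0)$ has measure $2^{-A}$. For
    $d_A = e_A^{1/p} 2^{A(1/p-1)}$ the integral of this sum is $\sum_A e_A$
    ([Hp_norm_haar_martingale]).

    Lower bound. For $n = 2^A+2$ the sum $n \sigma_n f = \sum_{j<n} S_j f$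
    involves only coefficients of index at most $2^A$, and the last of them
    appears exactly once, as $d_A \kappa_{2^A}$, whose modulus is $d_A$ on the
    whole group. Hence $|\sigma_n f| \geq d_A / n - C_A$ everywhere, where
    $C_A = \sum_{B<A} 2^B d_B$ bounds all the partial sums $S_j f$ with
    $j \leq 2^A$ ([kaczmarz_fejer_lower], [sum_kaczmarz_coef_haar]). As the
    group has measure 1, this number is also a lower bound for the weak norm.

    It remains to choose summable weights $e_A$ such that, for every $M$, some
    $A$ satisfies $d_A \geq n \varphi(n) (M + C_A)$ with $n = 2^A+2$. The ratio
    $2^{A(1/p-1)} / (n \varphi(n))$ is comparable to $n^{1/p-2} / \varphi(n)$,
    and it is unbounded because of the limsup condition and of the monotonicity
    of $\varphi$ ([growth_along_powers]). So one can scan the indices $A$ in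
    increasing order and insert an atom of weight $2^{-k}$, where $k$ atoms have
    been inserted before, as soon as it dominates them ([gliding_hump]). *)

(** * Functions of finitely many coordinates *)

Definition depends_on_first (T : Type) (N : nat) (g : walsh_group -> T) :
    Prop :=
  forall x y, (forall i, (i < N)%N -> x i = y i) -> g x = g y.

Definition zero_extension (N : nat) (t : N.-tuple bool) : walsh_group :=
  fun i => nth false t i.

Definition truncation (N : nat) (x : walsh_group) : walsh_group :=
  zero_extension N [tuple x i | i < N].

Lemma truncationE (N i : nat) (x : walsh_group) :
  (i < N)%N -> truncation N x i = x i.
Proof.
move=> iN; rewrite /truncation /zero_extension.
by rewrite (nth_mktuple _ _ (Ordinal iN)).
Qed.

Lemma depends_truncation T N (g : walsh_group -> T) (x : walsh_group) :
  depends_on_first T N g -> g x = g (truncation N x).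
Proof. by apply=> i iN; rewrite truncationE. Qed.

Lemma depends_leq T M N (g : walsh_group -> T) :
  (M <= N)%N -> depends_on_first T M g -> depends_on_first T N g.
Proof. by move=> MN hg x y xy; apply: hg => i /leq_trans/(_ MN)/xy. Qed.

Lemma dyadic_filtration_depends N (A : set walsh_group) :
  dyadic_filtration N A -> depends_on_first Prop N A.
Proof.
pose C : set (set walsh_group) := [set B | depends_on_first Prop N B].
suff : dyadic_filtration N `<=` C by apply.
apply: smallest_sub; last first.
  move=> _ [x _ <-] y z yz; apply/propext.
  by split=> h i iN; [rewrite -yz|rewrite yz]; rewrite ?h.
split.
- by move=> x y _.
- by move=> B hB x y /hB xy; rewrite /setD/= xy.
- move=> F hF x y xy; apply/propext.
  by split=> -[i _ Fi]; exists i => //;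
    [rewrite -(hF i _ _ xy)|rewrite (hF i _ _ xy)].
Qed.

(** A set that is determined by the first [N] coordinates is the union of the
    finitely many dyadic intervals of rank [N] that it meets. *)
Lemma depends_dyadic_filtration N (A : set walsh_group) :
  depends_on_first Prop N A -> dyadic_filtration N A.
Proof.
move=> hA.
have -> : A = \bigcup_(t in [set t : N.-tuple bool | A (zero_extension N t)])
    dyadic_interval N (zero_extension N t).
  apply/seteqP; split=> x /=.
    rewrite (depends_truncation _ _ _ x hA) => Ax.
    by exists [tuple x i | i < N] => // i iN; apply/esym; exact: truncationE.
  by move=> [t /= At xt]; rewrite (hA _ _ xt).
apply: (@fin_bigcup_measurable _
  (g_sigma_algebraType (range (dyadic_interval N)))) => //.
by move=> t _; apply: sub_sigma_algebra; exists (zero_extension N t).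
Qed.

Lemma depends_measurable N (A : set walsh_group) :
  depends_on_first Prop N A -> measurable A.
Proof.
move/depends_dyadic_filtration.
have : dyadic_filtration N `<=` measurable; last exact.
apply: (smallest_sub (@sigma_algebra_measurable _ walsh_group)) => _ [x _ <-].
exact: measurable_dyadic_interval.
Qed.

Lemma depends_comp T U N (h : T -> U) (g : walsh_group -> T) :
  depends_on_first T N g -> depends_on_first U N (h \o g).
Proof. by move=> hg x y xy /=; rewrite (hg x y xy). Qed.

Section integration.
Context (R : realType).
Local Notation mu := (walsh_measure R).

Lemma depends_measurable_fun N (g : walsh_group -> R) :
  depends_on_first R N g -> measurable_fun setT g.
Proof.
move=> hg _ B _; rewrite setTI.
exact: (depends_measurable N (g @^-1` B) (depends_comp _ _ N B g hg)).
Qed.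

Lemma depends_integrable N (g : walsh_group -> R) (A : set walsh_group) :
  measurable A -> depends_on_first R N g -> mu.-integrable A (EFin \o g).
Proof.
move=> mA hg; apply: (integrableS measurableT) => //.
apply: measurable_bounded_integrable => //.
- by rewrite /= probability_setT ltry.
- exact: depends_measurable_fun hg.
- exists (\sum_(t : N.-tuple bool) `|g (zero_extension N t)|); split.
    exact: num_real.
  move=> M ltM x _; apply: le_trans (ltW ltM).
  rewrite (depends_truncation _ _ _ x hg).
  by rewrite (bigD1 [tuple x i | i < N])//= lerDl sumr_ge0.
Qed.

(** * Invariance under the change of one coordinate *)

Definition flip (B : nat) (x : walsh_group) : walsh_group :=
  fun i => if i == B then ~~ x i else x i.

Lemma flip_depends T N B (g : walsh_group -> T) x :
  depends_on_first T N g -> (N <= B)%N -> g (flip B x) = g x.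
Proof.
move=> hg NB; apply: hg => i iN; rewrite /flip.
by case: eqP => // iB; move: NB; rewrite -iB leqNgt iN.
Qed.

Lemma measurable_flip B : measurable_fun setT (flip B).
Proof.
apply: (@measurability _ _ walsh_group walsh_group setT (flip B)
  coordinate_sets erefl).
move=> _ [_ [k _ [C _ <-]] <-]; rewrite !setTI.
exact: (measurable_coordinate k [set b | C (if k == B then ~~ b else b)]).
Qed.

Lemma fair_coin_negb (A : set bool) :
  fair_coin R [set b | A (~~ b)] = fair_coin R A.
Proof.
rewrite -[LHS]/(bernoulli_prob (2^-1 : R) _).
rewrite -[RHS]/(bernoulli_prob (2^-1 : R) _).
have h : (0 <= (2^-1 : R) <= 1)%R by rewrite invr_ge0 ler0n invf_le1//= ler1n.
rewrite !bernoulli_probE// !diracE.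
have -> : unstable.onem (2^-1 : R) = 2^-1 by rewrite /unstable.onem; lra.
have e b : (b \in [set b | A (~~ b)]) = (~~ b \in A).
  by apply/idP/idP; rewrite !in_setE.
by rewrite !e/= addeC.
Qed.

Lemma walsh_measure_flip B (A : set walsh_group) :
  measurable A -> mu (flip B @^-1` A) = mu A.
Proof.
move=> mA; pose f : {mfun walsh_group >-> walsh_group} :=
  mfun_Sub (mem_set (measurable_flip B)).
suff H : is_product_measure (distribution mu f).
  exact: (Defs.product_measure_unique H (walsh_measureP R) mA).
move=> n C.
have H := walsh_measureP R n
  (fun i => [set b | C i (if i == B then ~~ b else b)]).
apply: etrans H _.
by apply: eq_bigr => i _; case: eqP => // _; exact: fair_coin_negb.
Qed.

(** Changing the coordinate [B] preserves the measure and [A], and turns [g]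
    into [- g]: the integral equals its own opposite. *)
Lemma integral_flip_odd N B (A : set walsh_group) (g : walsh_group -> R) :
  measurable A -> (forall x, A (flip B x) = A x) ->
  depends_on_first R N g -> (forall x, g (flip B x) = - g x) ->
  (\int[mu]_(x in A) (g x)%:E = 0)%E.
Proof.
move=> mA Aflip hg gflip.
have ig : mu.-integrable A (EFin \o g) by exact: depends_integrable hg.
have Apre : flip B @^-1` A = A by apply/seteqP; split=> x /=; rewrite Aflip.
have E : (\int[mu]_(x in A) (g x)%:E = - \int[mu]_(x in A) (g x)%:E)%E.
  rewrite -[in RHS]integralN/=; last first.
    by rewrite fin_num_adde_defl// fin_numN; apply: integrable_neg_fin_num ig.
  transitivity (\int[mu]_(x in flip B @^-1` A) ((EFin \o g) \o flip B) x)%E.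
    rewrite -integral_pushforward//=.
    - apply: eq_measure_integral => //; first exact: measurable_flip.
      by move=> mf C mC _; apply/esym; exact: walsh_measure_flip.
    - exact: measurable_flip.
    - by apply/measurable_EFinP; exact: depends_measurable_fun hg.
    - rewrite Apre; apply: (depends_integrable (maxn N B.+1)) => // x y xy.
      apply: hg => i iN; rewrite /flip.
      by rewrite xy // leq_max iN.
  by rewrite Apre; apply: eq_integral => x _ /=; rewrite gflip EFinN.
have fing : (\int[mu]_(x in A) (g x)%:E)%E \is a fin_num.
  exact: integrable_fin_num ig.
move: E fing; case: (\int[mu]_(x in A) (g x)%:E)%E => //= r [] rE _.
by congr (_%:E); lra.
Qed.

End integration.

(** * The atoms and the martingales that they span *)

Section haar.
Context {R : realType}.
Local Notation mu := (walsh_measure R).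

Definition zero_prefix (A : nat) (x : walsh_group) : bool :=
  [forall i : 'I_A, ~~ x i].

(** In terms of Dirichlet kernels this is $D_{2^{A+1}} - D_{2^A}$, which is the
    sum of the Kaczmarz functions of index in $[2^A, 2^{A+1})$. *)
Definition haar (A : nat) (x : walsh_group) : R :=
  rademacher A x * (2 ^+ A * (zero_prefix A x)%:R).

Definition haar_martingale (d : nat -> R) (n : nat) (x : walsh_group) : R :=
  \sum_(A < n) d A * haar A x.

Lemma zero_prefixP A x :
  reflect (forall i, (i < A)%N -> x i = false) (zero_prefix A x).
Proof.
apply: (iffP forallP) => [h i iA|h i].
  by have /negbTE := h (Ordinal iA).
by rewrite h.
Qed.

Lemma zero_prefix_depends A : depends_on_first bool A (zero_prefix A).
Proof.
move=> x y xy; apply/zero_prefixP/zero_prefixP => h i iA.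
  by rewrite -xy// h.
by rewrite xy// h.
Qed.

Lemma rademacher_depends A : depends_on_first R A.+1 (rademacher A).
Proof. by move=> x y xy; rewrite /rademacher xy. Qed.

Lemma rademacher_flip A x : rademacher A (flip A x) = - rademacher A x :> R.
Proof. by rewrite /rademacher /flip eqxx; case: (x A); rewrite ?opprK. Qed.

Lemma normr_rademacher A x : `|rademacher A x : R| = 1.
Proof. by rewrite /rademacher normrX normrN1 expr1n. Qed.

Lemma haar_depends A : depends_on_first R A.+1 (haar A).
Proof.
move=> x y xy; rewrite /haar (rademacher_depends A x y xy).
by rewrite (zero_prefix_depends A x y) // => i /ltnW/xy.
Qed.

Lemma haar_flip A x : haar A (flip A x) = - haar A x.
Proof.
rewrite /haar rademacher_flip mulNr.
by rewrite (flip_depends _ _ _ _ _ (zero_prefix_depends A)).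
Qed.

Lemma normr_haar A x : `|haar A x| = 2 ^+ A * (zero_prefix A x)%:R.
Proof. by rewrite normrM normr_rademacher mul1r ger0_norm// mulr_ge0. Qed.

Lemma integral_zero_prefix A :
  (\int[mu]_x ((zero_prefix A x)%:R%:E : \bar R) = (2 ^- A)%:E)%E.
Proof.
have E : zero_prefix A =1 (fun x => x \in dyadic_interval A (fun=> false)).
  by move=> x; apply/zero_prefixP/idP; rewrite in_setE.
under eq_integral do rewrite E.
rewrite -(walsh_measure_dyadic_interval R A (fun=> false)).
rewrite -[in RHS](setIT (dyadic_interval _ _)) -integral_indic//.
exact: measurable_dyadic_interval.
Qed.

Lemma haar_martingale_depends d n : depends_on_first R n (haar_martingale d n).
Proof.
move=> x y xy; apply: eq_bigr => A _; congr (_ * _).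
by apply: haar_depends => i iA; apply: xy; exact: leq_trans iA (ltn_ord A).
Qed.

(** The increment of rank [n] is odd in the coordinate [n], and a set of the
    filtration at a time at most [n] does not depend on that coordinate. *)
Lemma haar_martingaleP d : dyadic_martingale (haar_martingale d).
Proof.
have mF n A : dyadic_filtration n A -> measurable A.
  by move=> /dyadic_filtration_depends/depends_measurable.
split.
- move=> n _ [B _ <-]; rewrite setTI.
  apply: depends_dyadic_filtration.
  exact: (depends_comp _ _ n B _ (haar_martingale_depends d n)).
- move=> n; apply: (depends_integrable R n) => //.
  exact: haar_martingale_depends.
move=> m n mn A FA; have mA := mF _ _ FA.
have dA := dyadic_filtration_depends _ _ FA.
elim: n mn => [|n ih]; first by rewrite leqn0 => /eqP ->.
rewrite leq_eqVlt => /predU1P[-> //|]; rewrite ltnS => mn.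
rewrite -(ih mn).
transitivity (\int[mu]_(x in A) ((haar_martingale d n x)%:E
   + (d n * haar n x)%:E))%E.
  by apply: eq_integral => x _; rewrite /haar_martingale big_ord_recr.
have dh : depends_on_first R n.+1 (fun x => d n * haar n x).
  by move=> x y xy; rewrite (haar_depends n x y xy).
rewrite integralD//=.
- rewrite (integral_flip_odd R n.+1 n A (fun x => d n * haar n x))// ?adde0//.
    by move=> x; exact: (flip_depends _ _ _ _ _ dA).
  by move=> x; rewrite haar_flip mulrN.
- by apply: (depends_integrable R n) => //; exact: haar_martingale_depends.
- exact: depends_integrable dh.
Qed.

(** * Walsh-Kaczmarz coefficients *)

Lemma binary_orderE n : (0 < n)%N -> binary_order n = trunc_log 2 n.
Proof.
move=> n0; have /andP[lo hi] := trunc_log_bounds (isT : (1 < 2)%N) n0.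
set t := trunc_log 2 n in lo hi *.
have dt : binary_digit n t.
  rewrite /binary_digit (_ : n %/ 2 ^ t = 1)%N//.
  apply/eqP; rewrite eqn_leq leq_divRL ?expn_gt0// mul1n lo andbT.
  by rewrite -ltnS ltn_divLR ?expn_gt0// -expnS.
have tn : (t < n)%N by apply: leq_trans lo; exact: ltn_expl.
apply/eqP; rewrite eqn_leq; apply/andP; split.
  apply/bigmax_leqP => j dj; rewrite leqNgt; apply/negP => tj; move: dj.
  rewrite /binary_digit divn_small// (leq_trans hi)//.
  by rewrite leq_exp2l.
exact: (leq_bigmax_cond (Ordinal tn) dt).
Qed.

Lemma binary_order_block A i :
  (2 ^ A <= i < 2 ^ A.+1)%N -> binary_order i = A.
Proof.
move=> h; rewrite binary_orderE; first exact: trunc_log_eq h.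
by have /andP[h1 _] := h; apply: leq_trans h1; rewrite expn_gt0.
Qed.

Lemma normr_kaczmarz n x : `|kaczmarz n x : R| = 1.
Proof.
rewrite /kaczmarz; case: eqP => _; first by rewrite normr1.
rewrite normrM normr_rademacher mul1r normr_prod big1// => k _.
by rewrite normrX normr_rademacher expr1n.
Qed.

Lemma kaczmarz_depends n :
  (0 < n)%N -> depends_on_first R (binary_order n).+1 (kaczmarz n).
Proof.
move=> n0 x y xy; rewrite /kaczmarz gtn_eqF// (rademacher_depends _ x y xy).
congr (_ * _); apply: eq_bigr => k _; congr (_ ^+ _).
by rewrite /rademacher xy// ltnS -subnDA leq_subr.
Qed.

Lemma kaczmarz_flip n x : (0 < n)%N ->
  kaczmarz n (flip (binary_order n) x) = - kaczmarz n x :> R.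
Proof.
move=> n0; rewrite /kaczmarz gtn_eqF// rademacher_flip mulNr; congr (- (_ * _)).
apply: eq_bigr => k _; congr (_ ^+ _); rewrite /rademacher /flip.
rewrite ltn_eqF// -subnDA ltn_subrL addnC addn1/=.
exact: leq_ltn_trans (leq0n _) (ltn_ord k).
Qed.

Lemma kaczmarz_zero_prefix n x : (0 < n)%N -> zero_prefix (binary_order n) x ->
  kaczmarz n x = rademacher (binary_order n) x :> R.
Proof.
move=> n0 /zero_prefixP h; rewrite /kaczmarz gtn_eqF// big1 ?mulr1// => k _.
rewrite /rademacher h ?expr0 ?expr1n//.
rewrite -subnDA ltn_subrL addnC addn1/=.
exact: leq_ltn_trans (leq0n _) (ltn_ord k).
Qed.

Lemma kaczmarz_depends_gt n N : (binary_order n < N)%N ->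
  depends_on_first R N (kaczmarz n).
Proof.
case: (posnP n) => [-> _ x y _|n0 nN]; first by rewrite /kaczmarz eqxx.
exact: depends_leq nN (kaczmarz_depends n n0).
Qed.

(** Let $i > 0$. If $A \neq |i|$, the product is odd in the coordinate
    $\max(A, |i|)$, on which only one of the two factors depends. If $A = |i|$,
    the factor $\kappa_i$ equals $r_A$ on the support of the other, so that the
    product is $2^A 1_{I_A(0)}$. For $i = 0$ the product is odd in the
    coordinate $A$. *)
Lemma integral_haar_kaczmarz A i :
  (\int[mu]_x (haar A x * kaczmarz i x)%:E
   = (((0 < i) && (A == binary_order i))%N%:R)%:E)%E.
Proof.
set N := (maxn A (binary_order i)).+1.
have dhk : depends_on_first R N (fun x => haar A x * kaczmarz i x).
  move=> x y xy; congr (_ * _).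
    by apply: haar_depends => j jA; apply: xy; rewrite ltnS leq_max -ltnS jA.
  apply: (kaczmarz_depends_gt i N) => //.
  by rewrite ltnS leq_maxr.
have [i0|] := boolP (0 < i)%N; last first.
  rewrite -eqn0Ngt => /eqP i0.
  apply: (integral_flip_odd R N A setT
    (fun x => haar A x * kaczmarz i x)) => //.
  by move=> x; rewrite i0 /kaczmarz eqxx haar_flip mulNr.
case: (ltngtP A (binary_order i)) => [Ai|iA|Ai] /=.
- apply: (integral_flip_odd R N (binary_order i) setT
    (fun x => haar A x * kaczmarz i x)) => //.
  move=> x; rewrite kaczmarz_flip// mulrN.
  by rewrite (flip_depends _ _ _ _ _ (haar_depends A)).
- apply: (integral_flip_odd R N A setT
    (fun x => haar A x * kaczmarz i x)) => //.
  move=> x; rewrite haar_flip mulNr.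
  by rewrite (flip_depends _ _ _ _ _ (kaczmarz_depends i i0)).
transitivity (\int[mu]_x ((2 ^+ A)%:E * (zero_prefix A x)%:R%:E))%E.
  apply: eq_integral => x _; rewrite -EFinM; congr (_%:E).
  rewrite /haar; case zA : (zero_prefix A x); last by rewrite !mulr0 mul0r.
  rewrite kaczmarz_zero_prefix -?Ai// mulrAC -expr2.
  by rewrite -real_normK ?num_real// normr_rademacher expr1n mul1r.
rewrite integralZl//; last first.
  apply: (depends_integrable R A) => //.
  exact: (depends_comp _ _ A (fun b : bool => b%:R) _ (zero_prefix_depends A)).
by rewrite integral_zero_prefix -EFinM divff// expf_neq0.
Qed.

(** The integrals that define the coefficient of index $i$ are constant as soon
    as the martingale has reached rank $|i|+1$. *)
Lemma kaczmarz_coef_haar d i : kaczmarz_coef (haar_martingale d) i =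
  if i is 0 then 0 else d (binary_order i).
Proof.
have select k j : (binary_order j < k)%N ->
    \sum_(A < k) d A * ((0 < j) && (A == binary_order j :> nat))%N%:R
    = if j is 0 then 0 else d (binary_order j).
  case: j => [|j] jk; first by rewrite big1// => A _; rewrite mulr0.
  rewrite (bigD1 (Ordinal jk))//= eqxx mulr1 big1 ?addr0// => A.
  by rewrite -val_eqE/= => /negbTE ->; rewrite mulr0.
rewrite /kaczmarz_coef; apply: cvg_lim; first exact: Rhausdorff.
apply: (@cvg_trans _ (cst (if i is 0 then 0 else d (binary_order i)) @ \oo));
  last exact: cvg_cst.
apply: near_eq_cvg; near=> k; rewrite /cst.
have ik : (binary_order i < k)%N by near: k; exact: nbhs_infty_gt.
rewrite /Rintegral.
transitivity (fine (\sum_(A < k)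
    (d A)%:E * \int[mu]_x (haar A x * kaczmarz i x)%:E)%E).
  under eq_bigr do rewrite integral_haar_kaczmarz -EFinM.
  by rewrite sumEFin/= select.
congr fine; apply/esym.
have dhk (A : 'I_k) : depends_on_first R k (fun x => haar A x * kaczmarz i x).
  move=> x y xy; congr (_ * _).
    by apply: haar_depends => j jA; apply: xy; exact: leq_trans jA (ltn_ord A).
  exact: (kaczmarz_depends_gt i k).
transitivity (\int[mu]_x (\sum_(A < k) (d A * (haar A x * kaczmarz i x))%:E))%E.
  apply: eq_integral => x _; rewrite sumEFin /haar_martingale mulr_suml.
  by congr (_%:E); apply: eq_bigr => A _; rewrite mulrA.
rewrite integral_sum//; last first.
  move=> A; apply: (depends_integrable R k) => // x y xy.
  by rewrite (dhk A x y xy).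
apply: eq_bigr => A _; under eq_integral do rewrite EFinM.
by rewrite integralZl//; exact: (depends_integrable R k).
Unshelve. all: by end_near. Qed.

End haar.

(** * The Hardy norm *)

Section hardy.
Context {R : realType}.
Local Notation mu := (walsh_measure R).

Lemma powR_addr_le (p a b : R) : 0 < p <= 1 -> 0 <= a -> 0 <= b ->
  (a + b) `^ p <= a `^ p + b `^ p.
Proof.
move=> /andP[p0 p1] a0 b0.
have [s0|s0] := eqVneq (a + b) 0.
  by rewrite s0 powR0 ?gt_eqF// addr_ge0 ?powR_ge0.
have s_gt0 : 0 < a + b by rewrite lt_def s0 addr_ge0.
(* on the unit interval a number is at most its p-th power *)
have frac c : 0 <= c -> c <= a + b -> (a + b) `^ p * (c / (a + b)) <= c `^ p.
  rewrite le_eqVlt => /predU1P[<- _|c0 cs].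
    by rewrite mul0r mulr0 powR_ge0.
  rewrite [leRHS](_ : _ = (a + b) `^ p * (c / (a + b)) `^ p); last first.
    by rewrite -powRM ?divr_ge0 ?ltW// mulrCA divff// mulr1.
  rewrite ler_pM2l ?powR_gt0// ger1_powR//.
  by rewrite divr_gt0//= ler_pdivrMr// mul1r.
apply: le_trans (lerD (frac a a0 _) (frac b b0 _)); rewrite ?lerDl ?lerDr//.
by rewrite -mulrDr -mulrDl divff// mulr1.
Qed.

Lemma powR_sum_le (p : R) (n : nat) (a : nat -> R) :
  0 < p <= 1 -> (forall i, 0 <= a i) ->
  (\sum_(i < n) a i) `^ p <= \sum_(i < n) a i `^ p.
Proof.
move=> hp a0; elim: n => [|n ih].
  by rewrite !big_ord0 powR0// gt_eqF//; case/andP: hp.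
rewrite !big_ord_recr/=; apply: le_trans (powR_addr_le _ _ _ hp _ _) _ => //.
  exact: sumr_ge0.
exact: lerD.
Qed.

Lemma measurable_maximal_function (f : nat -> walsh_group -> R) :
  (forall n, measurable_fun setT (f n)) ->
  measurable_fun setT (maximal_function f).
Proof.
move=> mf.
have -> : maximal_function f = fun x => esups (fun n => `|f n x|%:E) 0.
  apply/funext => x; rewrite /esups /maximal_function; congr ereal_sup.
  by apply/seteqP; split=> _ [n _ <-]; exists n.
apply: measurable_fun_esups => n; apply/measurable_EFinP.
by apply: measurableT_comp => //; exact: mf.
Qed.

(** As $p \leq 1$, the $p$-th power of a sum is at most the sum of the $p$-th
    powers, so the maximal function is dominated atom by atom. *)
Lemma Hp_norm_haar_martingale (p C : R) (d : nat -> R) :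
  0 < p <= 1 ->
  (forall N, \sum_(A < N) (`|d A| * 2 ^+ A) `^ p * 2 ^- A <= C) ->
  (Hp_norm p (haar_martingale d) < +oo)%E.
Proof.
move=> hp hC; have /andP[p0 p1] := hp.
pose s A (x : walsh_group) : \bar R :=
  ((`|d A| * 2 ^+ A) `^ p * (zero_prefix A x)%:R)%:E.
have s0 A x : (0 <= s A x)%E by rewrite lee_fin mulr_ge0 ?powR_ge0.
have ds A : depends_on_first R A
    (fun x => (`|d A| * 2 ^+ A) `^ p * (zero_prefix A x)%:R).
  by move=> x y xy; rewrite (zero_prefix_depends A x y xy).
have ms A : measurable_fun setT (s A).
  by apply/measurable_EFinP; exact: depends_measurable_fun (ds A).
have is_ A : (\int[mu]_x s A x = ((`|d A| * 2 ^+ A) `^ p * 2 ^- A)%:E)%E.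
  under eq_integral do rewrite /s EFinM.
  rewrite ge0_integralZl//=; first by rewrite integral_zero_prefix.
  apply/measurable_EFinP; apply: (depends_measurable_fun R A).
  by move=> x y xy; rewrite (zero_prefix_depends A x y xy).
have fin_le n x : ((`|haar_martingale d n x|%:E `^ p) <= \sum_(A <oo) s A x)%E.
  apply: le_trans (nneseries_lim_ge n _) => //.
  rewrite big_mkord sumEFin poweR_EFin lee_fin.
  apply: (@le_trans _ _ ((\sum_(A < n) `|d A * haar A x|) `^ p)).
    apply: (ge0_ler_powR (ltW p0)); rewrite ?nnegrE ?sumr_ge0//.
    exact: ler_norm_sum.
  apply: (le_trans (powR_sum_le _ n (fun A => `|d A * haar A x|) hp _)) => //.
  apply: ler_sum => A _; rewrite normrM normr_haar mulrA.
  rewrite powRM ?mulr_ge0//; case: zero_prefix.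
    by rewrite powR1.
  by rewrite powR0 ?gt_eqF.
have max_le x : (`|maximal_function (haar_martingale d) x| `^ p
    <= \sum_(A <oo) s A x)%E.
  have S0 : (0 <= \sum_(A <oo) s A x)%E by apply: nneseries_ge0 => A _ _.
  have m0 : (0 <= maximal_function (haar_martingale d) x)%E.
    apply: le_ereal_sup_tmp.
    exists `|haar_martingale d 0 x|%:E => //; exists 0%N.
  rewrite gee0_abs//.
  have -> : (\sum_(A <oo) s A x = ((\sum_(A <oo) s A x) `^ p^-1) `^ p)%E.
    by rewrite -poweRrM mulVf ?gt_eqF// poweRe1.
  apply: (gt0_ler_poweR (ltW p0)); rewrite ?in_itv/= ?leey ?andbT ?poweR_ge0//.
  apply: ge_ereal_sup => _ [n _ <-].
  have -> : (`|haar_martingale d n x|%:E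
      = (`|haar_martingale d n x|%:E `^ p) `^ p^-1)%E.
    by rewrite -poweRrM mulfV ?gt_eqF// poweRe1.
  have p'0 : 0 <= p^-1 by rewrite invr_ge0 ltW.
  apply: (gt0_ler_poweR p'0); rewrite ?in_itv/= ?leey ?andbT ?poweR_ge0//.
  exact: fin_le.
rewrite /Hp_norm unlock; apply: poweR_lty.
apply: (@le_lt_trans _ _ C%:E); last exact: ltry.
apply: (@le_trans _ _ (\int[mu]_x (\sum_(A <oo) s A x))%E).
  apply: ge0_le_integral => //.
  - by move=> x _; rewrite poweR_ge0.
  - have mm : measurable_fun setT (maximal_function (haar_martingale d)).
      apply: measurable_maximal_function => n.
      exact: depends_measurable_fun (haar_martingale_depends d n).
    apply: (@measurableT_comp _ _ _ _ _ _ (@poweR R ^~ p)) => //.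
      exact: measurable_poweR.
    exact: measurableT_comp.
  - by apply: ge0_emeasurable_sum => //.
rewrite integral_nneseries//; under eq_eseriesr do rewrite is_.
apply: lime_le.
  by apply: is_cvg_nneseries => A _ _; rewrite lee_fin mulr_ge0 ?powR_ge0.
apply: nearW => N; rewrite big_mkord sumEFin lee_fin; exact: hC.
Qed.

End hardy.

(** * Fejer means of index $2^A+2$ *)

Section fejer.
Context {R : realType}.

(** For $n = 2^A + 2$ the coefficient of index $2^A$ enters $n \sigma_n f$ only
    through the last partial sum, with the unimodular factor $\kappa_{2^A}$;
    all the other terms are controlled by the coefficients of lower index. *)
Lemma kaczmarz_fejer_lower (f : nat -> walsh_group -> R) A x :
  `|kaczmarz_coef f (2 ^ A)| <= (2 ^ A + 2)%N%:R *
    (`|kaczmarz_fejer f (2 ^ A + 2) x| + \sum_(i < 2 ^ A) `|kaczmarz_coef f i|).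
Proof.
set n := (2 ^ A + 2)%N; set C := \sum_(i < _) _; set c := kaczmarz_coef f.
have small j : (j <= 2 ^ A)%N -> `|kaczmarz_sum f j x| <= C.
  move=> jA; apply: le_trans (ler_norm_sum _ _ _) _.
  rewrite /C -(big_mkord xpredT (fun i => `|c i|)).
  rewrite (big_cat_nat (leq0n j) jA)//=.
  rewrite big_mkord ler_wpDr ?sumr_ge0//.
  by apply: ler_sum => i _; rewrite normrM normr_kaczmarz mulr1.
have E : c (2 ^ A)%N * kaczmarz (2 ^ A) x = n%:R * kaczmarz_fejer f n x
    - \sum_(j < (2 ^ A).+1) kaczmarz_sum f j x - kaczmarz_sum f (2 ^ A) x.
  rewrite /kaczmarz_fejer mulVKf ?pnatr_eq0 /n ?addn2// big_ord_recr/=.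
  have -> : kaczmarz_sum f (2 ^ A).+1 x
      = kaczmarz_sum f (2 ^ A) x + c (2 ^ A)%N * kaczmarz (2 ^ A) x.
    by rewrite /kaczmarz_sum big_ord_recr.
  by ring.
have -> : `|c (2 ^ A)%N| = `|c (2 ^ A)%N * kaczmarz (2 ^ A) x|.
  by rewrite normrM normr_kaczmarz mulr1.
rewrite E.
rewrite [leRHS]mulrDr; apply: le_trans (ler_normB _ _) _.
have -> : n%:R * C = (2 ^ A).+1%:R * C + C :> R.
  by rewrite /n addn2 -[(2 ^ A).+2%:R]natr1 mulrDl mul1r.
rewrite addrA lerD ?small//; apply: le_trans (ler_normB _ _) _.
rewrite lerD ?normrM ?normr_nat//; apply: le_trans (ler_norm_sum _ _ _) _.
apply: (@le_trans _ _ (\sum_(j < (2 ^ A).+1) C)).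
  by apply: ler_sum => j _; apply: small; rewrite -ltnS.
by rewrite sumr_const card_ord mulr_natl.
Qed.

Lemma sum_kaczmarz_coef_haar (d : nat -> R) A :
  \sum_(i < 2 ^ A) `|kaczmarz_coef (haar_martingale d) i|
  = \sum_(B < A) 2 ^+ B * `|d B|.
Proof.
elim: A => [|A ih].
  by rewrite big_ord_recr !big_ord0/= kaczmarz_coef_haar normr0 addr0.
rewrite big_ord_recr -ih/= -!(big_mkord xpredT
  (fun i => `|kaczmarz_coef (haar_martingale d) i|)).
have le2 : (2 ^ A <= 2 ^ A.+1)%N by rewrite leq_exp2l.
rewrite (big_cat_nat (leq0n _) le2)//=; congr (_ + _).
rewrite (eq_big_nat _ _ (F2 := fun=> `|d A|)); last first.
  move=> i hi; rewrite kaczmarz_coef_haar.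
  have : (0 < i)%N by have /andP[+ _] := hi; apply: leq_trans; rewrite expn_gt0.
  by case: i hi => // i hi _; rewrite (binary_order_block A).
rewrite sumr_const_nat -[_ *+ _]mulr_natl natrB// !natrX exprS.
by congr (_ * _); lra.
Qed.

End fejer.

(** * The choice of the coefficients *)

Section gliding_hump.
Context {R : realType}.
Variables (q : R) (u v w : nat -> R).
Hypothesis q0 : 0 < q.
Hypothesis v0 : forall A, 0 < v A.
Hypothesis unbounded : forall M N, exists2 A, (N <= A)%N & M * v A <= u A.

Let weight (k : nat) : R := 2 ^- k.

(** A state [(k, C)] records the number [k] of atoms chosen among the previous
    indices and their total contribution [C]. The next atom gets the weight
    $2^{-k}$, and is chosen as soon as it reaches $v_A (k + C)$: as [k] grows
    without bound, it plays the part of an arbitrary constant [M]. *)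
Let hit (A : nat) (s : nat * R) : bool :=
  v A * (s.1%:R + s.2) <= weight s.1 `^ q * u A.

Fixpoint hump_state (A : nat) : nat * R :=
  if A is B.+1 then
    let s := hump_state B in
    if hit B s then (s.1.+1, s.2 + w B * (weight s.1 `^ q * u B)) else s
  else (0%N, 0).

Let hump_weight (A : nat) : R :=
  if hit A (hump_state A) then weight (hump_state A).1 else 0.

Let hump_weight_ge0 A : 0 <= hump_weight A.
Proof.
rewrite /hump_weight; case: ifP => // _.
by rewrite invr_ge0 exprn_ge0.
Qed.

Let hump_weight_sum N :
  \sum_(A < N) hump_weight A = 2 - 2 * weight (hump_state N).1.
Proof.
elim: N => [|N ih].
  by rewrite big_ord0 /= /weight expr0 invr1 mulr1 subrr.
rewrite big_ord_recr/= {}ih /hump_weight.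
case: ifP => _ /=; last by rewrite addr0.
rewrite /weight exprS invfM; move: (2 ^+ _)^-1 => y; lra.
Qed.

Let hump_state_sum A : (hump_state A).2 =
  \sum_(B < A) w B * (hump_weight B `^ q * u B).
Proof.
elim: A => [|A ih]; first by rewrite big_ord0.
rewrite big_ord_recr/= -ih /hump_weight; case: ifP => _ //=.
by rewrite powR0 ?gt_eqF// mul0r mulr0 addr0.
Qed.

(** While no atom is chosen the state is constant, hence so is the multiple of
    [v] that [u] has to exceed. *)
Let hit_again A : exists B, hit B (hump_state B) /\ hump_state B = hump_state A.
Proof.
apply/not_existsP => nohit.
have stay B : (A <= B)%N -> hump_state B = hump_state A.
  elim: B => [|B ih]; first by rewrite leqn0 => /eqP ->.
  rewrite leq_eqVlt => /predU1P[-> //|]; rewrite ltnS => /ih sB /=.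
  by case: ifP => // hB; case: (nohit B).
set s := hump_state A in nohit stay *.
have w0 : 0 < weight s.1 `^ q by rewrite powR_gt0 // invr_gt0 exprn_gt0.
have [B AB large] := unbounded ((s.1%:R + s.2) / weight s.1 `^ q) A.
apply: (nohit B); split; last exact: stay.
by rewrite stay// /hit mulrC -ler_pdivrMl// mulrA [_^-1 * _]mulrC.
Qed.

Let hit_kth k : exists A, hit A (hump_state A) /\ (hump_state A).1 = k.
Proof.
elim: k => [|k [A [hA Ak]]].
  by have [A [hA sA]] := hit_again 0; exists A; rewrite {2}sA.
have [B [hB sB]] := hit_again A.+1; exists B; split=> //.
by rewrite sB/= hA /= Ak.
Qed.

Lemma gliding_hump : exists e : nat -> R,
  [/\ forall A, 0 <= e A,
      forall N, \sum_(A < N) e A <= 2 &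
      forall M, exists A, v A * (M + \sum_(B < A) w B * (e B `^ q * u B))
                          <= e A `^ q * u A].
Proof.
exists hump_weight; split=> //.
  by move=> N; rewrite hump_weight_sum gerBl mulr_ge0// invr_ge0 exprn_ge0.
move=> M; have [A [hA Ak]] := hit_kth (Num.truncn M).+1.
exists A; rewrite -hump_state_sum /hump_weight hA.
apply: le_trans hA; rewrite ler_pM2l// lerD2r Ak ltW//.
exact: truncnS_gt.
Qed.

End gliding_hump.

(** * The growth condition along the indices $2^A+2$ *)

Section growth.
Context {R : realType}.

Lemma limn_esup_pinfty (u : nat -> R) : limn_esup (EFin \o u) = +oo%E ->
  forall M N, exists2 n, (N <= n)%N & M < u n.
Proof.
move=> uoo M N; apply/not_exists2P => bounded.
suff : (limn_esup (EFin \o u) <= M%:E)%E by rewrite uoo.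
apply: (@le_trans _ _ (ereal_sup ((EFin \o u) @` [set n | (N <= n)%N]))).
  by apply: ereal_inf_lbound; exists [set n | (N <= n)%N] => //; exists N.
apply: ge_ereal_sup => _ [n /= Nn <-]; rewrite lee_fin leNgt; apply/negP => un.
by case: (bounded n).
Qed.

(** Each [n >= 3] lies between $2^A+2$ and $2^{A+1}+2 \leq 4 \cdot 2^A$ for some
    [A]; monotonicity of [phi] then transfers the growth to the lower end. *)
Lemma growth_along_powers (p : R) (phi : nat -> R) : 0 < p < 1 / 2 ->
  (forall n, (1 <= n)%N -> 1 <= phi n) ->
  (forall m n, (1 <= m)%N -> (m <= n)%N -> phi m <= phi n) ->
  limn_esup (fun n => (n%:R `^ (p^-1 - 2) / phi n)%:E) = +oo%E ->
  forall M N, exists2 A, (N <= A)%N &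
    M * ((2 ^ A + 2)%N%:R * phi (2 ^ A + 2)%N) <= (2 ^+ A) `^ (p^-1 - 1).
Proof.
move=> /andP[p0 p2] phi1 phile hlim M N.
have a0 : 0 < p^-1 - 2.
  by rewrite subr_gt0 -[ltLHS]invrK ltf_pV2 ?posrE ?invr_gt0// -[2^-1]mul1r.
set a := p^-1 - 2 in hlim a0 *.
have [n Nn large] := limn_esup_pinfty _ hlim (3 * 4 `^ a * `|M|) (2 ^ N + 2).
have nE : (n - 2 + 2 = n)%N by rewrite subnK// (leq_trans _ Nn)// leq_addl.
have NnB : (2 ^ N <= n - 2)%N by rewrite -(leq_add2r 2) nE.
have nB0 : (0 < n - 2)%N by apply: leq_trans NnB; rewrite expn_gt0.
have /andP[lo hi] := trunc_log_bounds (isT : (1 < 2)%N) nB0.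
set A := trunc_log 2 (n - 2) in lo hi *.
exists A; first by rewrite /A -(trunc_expnK N (isT : (1 < 2)%N)) leq_trunc_log.
set m := (2 ^ A + 2)%N; set t : R := 2 ^+ A.
have t1 : 1 <= t by rewrite exprn_ege1// ler1n.
have mn : (m <= n)%N by rewrite /m -nE leq_add2r.
have m0 : (0 < m)%N by rewrite /m addn2.
have phim : phi m <= phi n by exact: phile.
have phim1 : 1 <= phi m by exact: phi1.
have phin1 : 1 <= phi n := le_trans phim1 phim.
have m3 : m%:R <= 3 * t by rewrite /m natrD natrX -/t; lra.
have n4 : n%:R <= 4 * t.
  have : (n <= 2 ^ A.+1 + 1)%N by rewrite -nE addn2 addn1.
  by rewrite -(ler_nat R) natrD natrX exprS -/t; lra.
have na : n%:R `^ a <= 4 `^ a * t `^ a.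
  rewrite -powRM ?(le_trans ler01 t1)//.
  apply: (ge0_ler_powR (ltW a0)); rewrite ?nnegrE// mulr_ge0//.
  exact: le_trans ler01 t1.
have tE : t `^ (p^-1 - 1) = t * t `^ a.
  rewrite -mulr_powRB1 ?(le_trans ler01 t1)//; last by rewrite /a in a0; lra.
  by congr (_ * _ `^ _); rewrite /a; lra.
rewrite tE.
apply: (@le_trans _ _ (`|M| * (3 * t * phi n))).
  apply: (@le_trans _ _ (`|M| * (m%:R * phi m))).
    by rewrite ler_wpM2r ?ler_norm// mulr_ge0//; lra.
  by rewrite ler_wpM2l// ler_pM//; lra.
have P4 : 0 < 4 `^ a :> R by rewrite powR_gt0.
rewrite ltr_pdivlMr in large; last lra.
rewrite -(ler_pM2l P4).
have -> : 4 `^ a * (`|M| * (3 * t * phi n)) = t * (3 * 4 `^ a * `|M| * phi n).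
  by ring.
have -> : 4 `^ a * (t * t `^ a) = t * (4 `^ a * t `^ a) by ring.
by rewrite ler_wpM2l ?(le_trans ler01 t1)// (le_trans (ltW large)).
Qed.

End growth.

(** * Divergence in the weak space *)

Lemma weak_Lnorm_lower (R : realType) (P : probability walsh_group R)
    (p l : R) (g : walsh_group -> R) :
  0 < l -> (forall x, l < `|g x|) -> (l%:E <= weak_Lnorm P p g)%E.
Proof.
move=> l0 lg; apply: le_ereal_sup_tmp.
exists (l%:E * P [set x | (l < `|g x|)%R] `^ p^-1)%E; first by exists l.
rewrite (_ : [set x | _] = setT); last by apply/seteqP; split=> x //= _.
by rewrite probability_setT poweR1r mule1.
Qed.

Theorem theorem2 (R : realType) (p : R) (phi : nat -> R)
  (hp : 0 < p < 1 / 2)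
  (phi_ge1 : forall n, (1 <= n)%N -> 1 <= phi n)
  (phi_ndecr : forall m n, (1 <= m)%N -> (m <= n)%N -> phi m <= phi n)
  (phi_limsup :
    limn_esup (fun n => (n%:R `^ (p^-1 - 2) / phi n)%:E) = +oo%E) :
  exists f : nat -> walsh_group -> R,
    in_Hp p f /\
    ereal_sup [set weak_Lnorm (walsh_measure R) p
                     (fun x => kaczmarz_fejer f n x / phi n)
              | n in [set n | (1 <= n)%N]] = +oo%E.
Proof.
have /andP[p0 p2] := hp.
have p1 : 0 < p <= 1 by rewrite p0; lra.
pose u A : R := (2 ^+ A) `^ (p^-1 - 1).
pose v A : R := (2 ^ A + 2)%N%:R * phi (2 ^ A + 2)%N.
have m0 A : (0 < 2 ^ A + 2)%N by rewrite addn2.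
have phi0 A : 1 <= phi (2 ^ A + 2)%N by exact: phi_ge1.
have v0 A : 0 < v A.
  by rewrite mulr_gt0 ?ltr0n// (lt_le_trans ltr01).
have q0 : 0 < p^-1 by rewrite invr_gt0.
have uv := growth_along_powers p phi hp phi_ge1 phi_ndecr phi_limsup.
have [e [e0 e2 hump]] := gliding_hump p^-1 u v (fun B => 2 ^+ B) q0 v0 uv.
pose d A := e A `^ p^-1 * u A.
have d0 A : 0 <= d A by rewrite mulr_ge0 ?powR_ge0.
exists (haar_martingale d); split.
  split; first exact: haar_martingaleP.
  apply: (Hp_norm_haar_martingale p 2) => // N.
  rewrite (eq_bigr (fun A : 'I_N => e A)); first exact: e2.
  move=> A _.
  (* [u A] is the inverse of the H_p norm of [haar A], so that the A-th term
     contributes exactly [e A] *)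
  have -> : `|d A| * 2 ^+ A = (e A * 2 ^+ A) `^ p^-1.
    rewrite ger0_norm// /d /u -mulrA [_ `^ _ * 2 ^+ A]mulrC.
    by rewrite mulr_powRB1 ?exprn_ge0// powRM ?exprn_ge0.
  rewrite -powRrM mulVf ?gt_eqF// powRr1 ?mulr_ge0 ?exprn_ge0//.
  by rewrite mulfK// expf_neq0.
apply/eqyP => M M0; have [A hA] := hump (M + 1).
apply: le_ereal_sup_tmp; exists (weak_Lnorm (walsh_measure R) p
    (fun x => kaczmarz_fejer (haar_martingale d) (2 ^ A + 2) x
              / phi (2 ^ A + 2)%N)).
  by exists (2 ^ A + 2)%N => //; exact: m0.
apply: weak_Lnorm_lower => // x.
have phi_gt0 : 0 < phi (2 ^ A + 2)%N := lt_le_trans ltr01 (phi0 A).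
rewrite normrM normfV (gtr0_norm phi_gt0) ltr_pdivlMr//.
have := kaczmarz_fejer_lower (haar_martingale d) A x.
rewrite sum_kaczmarz_coef_haar kaczmarz_coef_haar.
have -> : (if (2 ^ A)%N is 0 then 0 else d (binary_order (2 ^ A))) = d A.
  rewrite (binary_order_block A) ?leqnn ?ltn_exp2l ?leqnn//.
  by have := expn_gt0 2 A; case: (2 ^ A)%N.
have -> : \sum_(B < A) 2 ^+ B * `|d B| = \sum_(B < A) 2 ^+ B * d B.
  by apply: eq_bigr => B _; rewrite ger0_norm.
rewrite (ger0_norm (d0 A)); set C := \sum_(B < A) _.
have C0 : 0 <= C by rewrite sumr_ge0// => B _; rewrite mulr_ge0.
move=> h; have := le_trans hA h; rewrite -/C /v -mulrA ler_pM2l ?ltr0n//.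
set F := `|_|; set f := phi _ in phi_gt0 *; have f1 : 1 <= f := phi0 A.
move=> hF; have : C <= f * C by rewrite ler_peMl.
by rewrite mulrDr in hF; rewrite mulrDr mulr1 in hF; rewrite mulrC; lra.
Qed.
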